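(* Let $G$ be a graph of size $m=|E(G)|$ with minimum degree $\delta(G)\ge 1$. Then $\rho_e^o(G)=m/\delta(G)$ if and only if either $G$ is a disjoint union of stars or $G\in\mathcal{F}$.
   Context: All graphs are finite and simple. A set $B\subseteq E(G)$ is an edge open packing set (EOP set) of $G$ if for every two distinct edges $e_1,e_2\in B$ there is no edge $e\in E(G)\setminus\{e_1,e_2\}$ joining an endvertex of $e_1$ to an endvertex of $e_2$ (i.e. there is no edge $e$ such that $e_1,e,e_2$ form a path with $e$ in the middle or a triangle). Two edges of $B$ are allowed to share an endvertex. The edge open packing number $\rho_e^o(G)$ is the maximum cardinality of an EOP set of $G$. A star is a graph $K_{1,r}$ with $r\ge 1$ (so $K_2=K_{1,1}$ is a star). The family $\mathcal{F}$ consists of all bipartite graphs $G$ of minimum degree $k\ge 2$ (for some integer $k$) whose vertex set can be partitioned into pairwise disjoint sets $A$, $B$, $C$ such that $A\cup C$ and $B$ are the partite sets of $G$, and every vertex in $B$ has exactly $1$ neighbor in $A$ and exactly $k-1$ neighbors in $C$. *)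

(* Defs.v *)
From HB Require Import structures.
From mathcomp Require Import all_boot all_order all_algebra.

Set Implicit Arguments.
Unset Strict Implicit.
Unset Printing Implicit Defensive.

Record sgraph := SGraph {
  vertex :> finType;
  adj : rel vertex;
  adj_sym : symmetric adj;
  adj_irrefl : irreflexive adj }.

Section Graph.
Variable G : sgraph.

Definition edges : {set {set G}} :=
  [set e : {set G} | [exists x, exists y, adj x y && (e == [set x; y])]].

Definition nbhd (v : G) : {set G} := [set w | adj v w].

(* Since degrees are smaller than #|G|, the default value #|G| of the minimum
   is irrelevant unless G has no vertices, in which case min_degree is 0. *)
Definition min_degree : nat := \big[minn/#|G|]_(v : G) #|nbhd v|.

Definition joins (e e1 e2 : {set G}) : bool :=
  [exists u in e1, exists v in e2, e == [set u; v]].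

Definition eop_set (B : {set {set G}}) : bool :=
  (B \subset edges) &&
  [forall e1 in B, forall e2 in B, (e1 != e2) ==>
     ~~ [exists e in edges :\: [set e1; e2], joins e e1 e2]].

Definition eop_number : nat := \max_(B : {set {set G}} | eop_set B) #|B|.

Definition independent (X : {set G}) : Prop :=
  {in X &, forall x y, ~~ adj x y}.

Definition partite_sets (X Y : {set G}) : Prop :=
  [/\ X :|: Y = [set: G], [disjoint X & Y], independent X & independent Y].

Definition in_family_F : Prop :=
  exists k : nat, [/\ 2 <= k, min_degree = k &
    exists A B C : {set G},
      [/\ A :|: B :|: C = [set: G],
          [/\ [disjoint A & B], [disjoint A & C] & [disjoint B & C]],
          partite_sets (A :|: C) B &
          {in B, forall b, #|nbhd b :&: A| = 1 /\ #|nbhd b :&: C| = k.-1}]].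

End Graph.

Definition isomorphic (G H : sgraph) : Prop :=
  exists2 f : G -> H, bijective f & forall x y, adj (f x) (f y) = adj x y.

Section CompleteBipartite.
Variables m n : nat.

Definition Kbip_rel : rel ('I_m + 'I_n)%type := fun x y =>
  match x, y with
  | inl _, inr _ | inr _, inl _ => true
  | _, _ => false
  end.

Lemma Kbip_sym : symmetric Kbip_rel.
Proof. by case=> ? [] ?. Qed.

Lemma Kbip_irrefl : irreflexive Kbip_rel.
Proof. by case. Qed.

Definition Kbip : sgraph := SGraph Kbip_sym Kbip_irrefl.
End CompleteBipartite.

Section DisjointUnion.
Variables (I : finType) (H : I -> sgraph).

Definition dunion_rel : rel {i : I & H i} := fun x y =>
  (tag x == tag y) && adj (tagged x) (tagged_as x y).

Lemma dunion_sym : symmetric dunion_rel.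
Proof.
case=> i x [j y]; rewrite /dunion_rel /=; case: (eqVneq i j) => //= eij.
by case: _ / eij y => y; rewrite !tagged_asE adj_sym.
Qed.

Lemma dunion_irrefl : irreflexive dunion_rel.
Proof. by case=> i x; rewrite /dunion_rel /= eqxx tagged_asE adj_irrefl. Qed.

Definition dunion : sgraph := SGraph dunion_sym dunion_irrefl.
End DisjointUnion.

Definition disjoint_union_of_stars (G : sgraph) : Prop :=
  exists (n : nat) (r : 'I_n -> nat),
    (forall i, 1 <= r i) /\ isomorphic G (dunion (fun i => Kbip 1 (r i))).

(* Main.v *)
Require Import Defs.
From mathcomp Require Import all_boot all_order all_algebra.

(** Let D be an edge open packing set of G.  Among the two ends of an edge of D
    at least one lies on no other edge of D, since otherwise that edge would
    join two further members of D ([eop_private]).  Choosing one such end on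
    every edge of D gives a set X of #|D| leaves.  For the same reason, a
    neighbour of the leaf x that is covered by D lies on the edge of D at x
    ([private_adj]); hence X is independent, and counting edges at X gives

      #|D| * delta(G) <= sum of the degrees over X
                       = number of edges that meet X <= #|E(G)|.

    If the outer terms agree, then every leaf has degree delta(G) and every edge
    meets X.  Thus G is bipartite with sides X and ~: X, and the latter splits
    into the vertices covered by D, of which each leaf sees exactly one, and the
    others ([eop_extremal]).  This is the partition that defines the family F,
    with the value k = delta(G) = 1 not excluded.

    Conversely, if G has such a partition (A, B, C) with parameter k, then
    #|E(G)| = k * #|B|, and the edges between A and B form an edge open packing
    set of #|B| edges.  So the equality holds exactly when G has such a
    partition with k = delta(G) ([eop_equality_star_partition]).  It remains to
    see that the partitions with k = 1 are those of the disjoint unions of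
    stars, A consisting of the centres and B of the leaves. *)

Set Implicit Arguments.
Unset Strict Implicit.
Unset Printing Implicit Defensive.

Import GRing.Theory Num.Theory.

(** * Edges, degrees and double counting *)

Section EdgesAndDegrees.
Variable G : sgraph.
Implicit Types (x y v : G) (e : {set G}) (X Y : {set G}).

Lemma min_degree_le v : min_degree G <= #|nbhd v|.
Proof.
rewrite /min_degree; have: v \in index_enum G by rewrite mem_index_enum.
elim: (index_enum G) => // u s IHs; rewrite inE big_cons geq_min.
by case: eqP => [->|_ /= /IHs ->]; rewrite ?leqnn ?orbT.
Qed.

Lemma min_degree_le_order : min_degree G <= #|G|.
Proof.
rewrite /min_degree; elim/big_rec: _ => // u d _ le_d.
by rewrite geq_min le_d orbT.
Qed.

Lemma edgesP e : reflect (exists x y, adj x y /\ e = [set x; y]) (e \in edges G).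
Proof.
rewrite inE; apply: (iffP existsP) => [[x /existsP[y /andP[xy /eqP->]]]|].
  by exists x, y.
by case=> x [y [xy ->]]; exists x; apply/existsP; exists y; rewrite xy eqxx.
Qed.

Lemma adj_neq x y : adj x y -> x != y.
Proof. by apply: contraTneq => ->; rewrite adj_irrefl. Qed.

Lemma edge_set2 e x y :
  e \in edges G -> x \in e -> y \in e -> x != y -> e = [set x; y].
Proof.
case/edgesP=> a [b [_ ->]]; rewrite !inE.
by case/orP=> /eqP-> /orP[] /eqP->; rewrite ?eqxx // setUC.
Qed.

Lemma edge_adj e x y :
  e \in edges G -> x \in e -> y \in e -> x != y -> adj x y.
Proof.
case/edgesP=> a [b [ab ->]]; rewrite !inE.
by case/orP=> /eqP-> /orP[] /eqP->; rewrite ?eqxx // adj_sym.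
Qed.

Lemma partite_adj X Y x y :
  partite_sets X Y -> adj x y -> (x \in Y) || (y \in Y).
Proof.
case=> defV _ indX _; apply: contraTT; rewrite negb_or => /andP[xY yY].
have inX z : z \notin Y -> z \in X.
  by move=> /negPf zY; have: z \in setT by []; rewrite -defV inE zY orbF.
by apply: indX; apply: inX.
Qed.

Definition edges_between X Y : {set {set G}} :=
  [set [set p.1; p.2] |
    p in [set p : G * G | [&& p.1 \in X, p.2 \in Y & adj p.1 p.2]]].

Lemma edges_betweenP X Y e :
  reflect (exists x y, [/\ x \in X, y \in Y, adj x y & e = [set x; y]])
          (e \in edges_between X Y).
Proof.
apply: (iffP imsetP) => [[[x y]]|[x [y [xX yY xy ->]]]].
  by rewrite inE => /and3P[/= xX yY xy] ->; exists x, y.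
by exists (x, y); rewrite // inE xX yY xy.
Qed.

Lemma edges_between_sub X Y : edges_between X Y \subset edges G.
Proof.
apply/subsetP=> e /edges_betweenP[x [y [_ _ xy ->]]].
by apply/edgesP; exists x, y.
Qed.

(** Independence of X makes the end in X of such an edge unique, even when Y
    contains X, so no edge is counted twice. *)
Lemma card_edges_between X Y :
  independent X -> #|edges_between X Y| = \sum_(x in X) #|nbhd x :&: Y|.
Proof.
move=> indX; rewrite card_in_imset => [|[a b] [c d]].
  rewrite -sum1_card (eq_bigl (fun p : G * G =>
    (p.1 \in X) && (p.2 \in nbhd p.1 :&: Y))); last first.
    by case=> x y; rewrite !inE /= [(y \in Y) && _]andbC.
  by rewrite -(pair_big_dep _ (fun x y => y \in nbhd x :&: Y) (fun _ _ => 1));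
     apply: eq_bigr => x _; rewrite sum1_card.
rewrite !inE /= => /and3P[aX _ ab] /and3P[cX _ cd] eq_e.
have: a \in [set c; d] by rewrite -eq_e set21.
rewrite !inE => /orP[] /eqP eq_a; last first.
  by case/negP: (indX _ _ cX aX); rewrite eq_a.
have: b \in [set c; d] by rewrite -eq_e set22.
rewrite !inE -eq_a => /orP[] /eqP eq_b; last by rewrite eq_b.
by move: ab; rewrite eq_b adj_irrefl.
Qed.

End EdgesAndDegrees.

(** * Edge open packing sets and their leaves *)

Section EdgeOpenPacking.
Variable G : sgraph.
Implicit Types (x y : G) (e : {set G}) (D : {set {set G}}) (X : {set G}).

(** The cases in which the two members of D coincide, or the joining edge is one
    of them, are absorbed by the membership in [set e1; e2]; this spares the
    inequality premises of the definition. *)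
Lemma eopP D :
  reflect (D \subset edges G /\ forall e1 e2 x y, e1 \in D -> e2 \in D ->
             x \in e1 -> y \in e2 -> adj x y -> [set x; y] \in [set e1; e2])
          (eop_set D).
Proof.
apply: (iffP andP) => -[sDE eopD]; split=> //.
  move=> e1 e2 x y De1 De2 xe1 ye2 xy.
  have [eq_e|neq_e] := eqVneq e1 e2.
    rewrite -eq_e in ye2 *; rewrite !inE orbb eq_sym; apply/eqP.
    by apply: edge_set2; rewrite ?(subsetP sDE) ?adj_neq.
  apply: contraTT eopD => notin; apply/forall_inPn; exists e1 => //.
  apply/forall_inPn; exists e2 => //; rewrite neq_e negbK.
  apply/exists_inP; exists [set x; y].
    by rewrite in_setD notin; apply/edgesP; exists x, y.
  by apply/exists_inP; exists x => //; apply/exists_inP; exists y.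
apply/forall_inP=> e1 De1; apply/forall_inP=> e2 De2; apply/implyP=> _.
apply/exists_inPn=> e; rewrite in_setD => /andP[notin Ee].
apply: contraNN notin => /exists_inP[x xe1 /exists_inP[y ye2 /eqP eq_e]].
rewrite eq_e; apply: eopD => //.
apply: (edge_adj Ee); rewrite ?eq_e ?set21 ?set22 //.
(* A singleton is not an edge. *)
move: Ee; rewrite eq_e => /edgesP[a [b [/adj_neq ab eq_ab]]].
apply: contraNneq ab => eq_xy.
have: a \in [set a; b] by rewrite set21.
have: b \in [set a; b] by rewrite set22.
by rewrite -eq_ab eq_xy !inE !orbb => /eqP-> /eqP->.
Qed.

Lemma leq_eop_number D : eop_set D -> #|D| <= eop_number G.
Proof. by move=> eopD; apply: (bigmax_sup D). Qed.

Lemma eop_number_attained :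
  exists2 D : {set {set G}}, eop_set D & #|D| = eop_number G.
Proof.
have eop0 : eop_set (set0 : {set {set G}}).
  by apply/eopP; split=> [|e1 e2 x y]; rewrite ?sub0set ?inE.
have: 0 < #|[pred D : {set {set G}} | eop_set D]|.
  by apply/card_gt0P; exists set0.
case/(eq_bigmax_cond (fun D : {set {set G}} => #|D|)) => D eopD eqD.
by exists D.
Qed.

Definition private D e x := x \in e /\ {in D, forall e', x \in e' -> e' = e}.

(** If x also lies on e1 in D and y on e2 in D, then the edge xy joins e1 and
    e2, so it is one of them. *)
Lemma eop_private D e : eop_set D -> e \in D -> exists x, private D e x.
Proof.
move=> /eopP[sDE eopD] De; have /edgesP[x [y [xy def_e]]] := subsetP sDE e De.
have [/forall_inP priv_x|] := boolP [forall e' in D, (x \in e') ==> (e' == e)].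
  exists x; split=> [|e' De' xe']; first by rewrite def_e set21.
  by apply/eqP; apply: implyP (priv_x e' De') xe'.
case/forall_inPn=> e1 De1; rewrite negb_imply => /andP[xe1 neq_e1].
exists y; split=> [|e2 De2 ye2]; first by rewrite def_e set22.
have := eopD e1 e2 x y De1 De2 xe1 ye2 xy.
by rewrite -def_e !inE [e == e1]eq_sym (negPf neq_e1) => /eqP.
Qed.

(** The edge xy joins e to the member of D that covers y, so it is one of the
    two; as x is private to e, it is e in both cases. *)
Lemma private_adj D e x y :
  eop_set D -> e \in D -> private D e x -> adj x y -> y \in cover D -> y \in e.
Proof.
move=> /eopP[_ eopD] De [xe priv_x] xy /bigcupP[e' De' ye'].
have := eopD e e' x y De De' xe ye' xy.
rewrite !inE => /orP[] /eqP def_e; first by rewrite -def_e set22.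
by rewrite -(priv_x e') // -def_e set21.
Qed.

(** The condition on e :&: X matters when e is a component of D by itself: both
    of its ends are then private, and X may contain only one of them. *)
Definition leaf_set D X :=
  {in X, forall x, exists2 e, e \in D & private D e x /\ e :&: X = [set x]}.

Lemma eop_leaf_set D : eop_set D -> exists2 X, leaf_set D X & #|X| = #|D|.
Proof.
move=> eopD.
(* Choosing over the subtype of members of D needs no default vertex. *)
have /fin_all_exists[f fP] (u : {e | e \in D}) : exists x, private D (val u) x.
  exact: eop_private eopD (valP u).
have f_inj (u v : {e | e \in D}) : f u \in val v -> u = v.
  by move=> fuv; apply/val_inj; rewrite -((fP u).2 _ (valP v) fuv).
exists (f @: setT) => [_ /imsetP[u _ ->]|]; last first.
  rewrite card_imset ?cardsT ?card_sig // => u v eq_f.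
  by apply: f_inj; rewrite eq_f (fP v).1.
exists (val u); first exact: valP.
split; first exact: fP.
apply/setP=> y; rewrite !inE; apply/andP/eqP=> [[yu /imsetP[v _ def_y]]|->].
  by rewrite def_y (f_inj v u) // -def_y.
by rewrite (fP u).1 imset_f.
Qed.

Lemma leaf_set_cover D X : leaf_set D X -> X \subset cover D.
Proof.
move=> leafX; apply/subsetP=> x /leafX[e De [[xe _] _]].
by apply/bigcupP; exists e.
Qed.

Lemma leaf_set_independent D X :
  eop_set D -> leaf_set D X -> independent X.
Proof.
move=> eopD leafX x y xX yX; apply/negP=> xy.
have [e De [priv_x eX]] := leafX x xX.
have yD := subsetP (leaf_set_cover leafX) y yX.
have: y \in e :&: X by rewrite inE (private_adj eopD De priv_x xy yD).
by rewrite eX inE => /eqP eq_yx; rewrite eq_yx adj_irrefl in xy.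
Qed.

Lemma sum_leaf_degree D X : eop_set D -> leaf_set D X ->
  \sum_(x in X) #|nbhd x| = #|edges_between X setT|.
Proof.
move=> eopD leafX; rewrite card_edges_between.
  by apply: eq_bigr => x _; rewrite setIT.
exact: leaf_set_independent leafX.
Qed.

Lemma eop_bound D : eop_set D -> #|D| * min_degree G <= #|edges G|.
Proof.
move=> eopD; have [X leafX <-] := eop_leaf_set eopD.
apply: leq_trans (subset_leq_card (edges_between_sub X setT)).
rewrite -(sum_leaf_degree eopD leafX) -sum_nat_const.
by apply: leq_sum => x _; apply: min_degree_le.
Qed.

End EdgeOpenPacking.

(** * The partitions of the extremal graphs *)

(** The partition required by the family F, kept apart from the bound 2 <= k:
    for k = 1 it describes the disjoint unions of stars. *)
Definition star_partition (G : sgraph) k (A B C : {set G}) :=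
  [/\ A :|: B :|: C = [set: G],
      [/\ [disjoint A & B], [disjoint A & C] & [disjoint B & C]],
      partite_sets (A :|: C) B &
      {in B, forall b, #|nbhd b :&: A| = 1 /\ #|nbhd b :&: C| = k.-1}].

(** Equality in [eop_bound] forces equality in both of its steps.  With a leaf
    set X as B, the class A consists of the covered vertices outside X and C of
    the uncovered vertices. *)
Lemma eop_extremal (G : sgraph) (D : {set {set G}}) :
    eop_set D -> #|D| * min_degree G = #|edges G| ->
  exists A B C : {set G}, star_partition (min_degree G) A B C.
Proof.
move=> eopD eq_m; have [X leafX cardX] := eop_leaf_set eopD.
have indX := leaf_set_independent eopD leafX.
have sXD := leaf_set_cover leafX.
have deg_ge : #|X| * min_degree G <= \sum_(x in X) #|nbhd x|
               ?= iff [forall (x | x \in X), min_degree G == #|nbhd x|].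
  rewrite -sum_nat_const; apply: leqif_sum => x _.
  by apply/leqif_eq/min_degree_le.
have le_m := subset_leq_card (edges_between_sub X setT).
have sum_m : \sum_(x in X) #|nbhd x| = #|edges G|.
  apply/eqP; rewrite eqn_leq -{2}eq_m -cardX deg_ge andbT.
  by rewrite (sum_leaf_degree eopD leafX).
have degX x : x \in X -> #|nbhd x| = min_degree G.
  move: deg_ge.2; rewrite sum_m cardX eq_m eqxx => /esym/forall_inP degX xX.
  by rewrite (eqP (degX x xX)).
have edgeX x y : adj x y -> (x \in X) || (y \in X).
  move=> xy; have: [set x; y] \in edges_between X setT.
    suff ->: edges_between X setT = edges G by apply/edgesP; exists x, y.
    apply/eqP; rewrite eqEcard edges_between_sub /=.
    by rewrite -(sum_leaf_degree eopD leafX) sum_m.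
  case/edges_betweenP=> a [b [aX _ _ eq_xy]].
  have: a \in [set x; y] by rewrite eq_xy set21.
  by rewrite !inE => /orP[] /eqP <-; rewrite aX ?orbT.
have def_AC : (cover D :\: X) :|: ~: cover D = ~: X.
  apply/setP=> x; rewrite !inE; have /implyP := subsetP sXD x.
  by case: (x \in X); case: (x \in cover D).
exists (cover D :\: X), X, (~: cover D); split.
- by rewrite -setUAC def_AC setUC setUCr.
- by split; rewrite -setI_eq0; apply/eqP/setP=> x; rewrite !inE;
    have /implyP := subsetP sXD x; case: (x \in X); case: (x \in cover D).
- rewrite def_AC; split=> //; first by rewrite setUC setUCr.
    by rewrite -setI_eq0 setIC setICr.
  move=> x y; rewrite !inE => xX yX; apply: contraNN xX => /edgeX.
  by rewrite (negPf yX) orbF.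
move=> x xX; have [e De [priv_x eX]] := leafX x xX.
have Ee : e \in edges G by case/eopP: eopD => /subsetP->.
have [xe _] := priv_x.
have nbhd_cover : nbhd x :&: cover D = e :\ x.
  apply/setP=> y; rewrite !inE; apply/andP/andP=> [[xy Dy]|[yx ye]].
    by rewrite eq_sym adj_neq //; split=> //; apply: private_adj priv_x xy Dy.
  split; first by apply: (edge_adj Ee); rewrite // eq_sym.
  by apply/bigcupP; exists e.
have card1 : #|nbhd x :&: cover D| = 1.
  rewrite nbhd_cover; have := cardsD1 x e; rewrite xe.
  by case/edgesP: Ee => a [b [/adj_neq ab ->]]; rewrite cards2 ab => -[].
split.
  (* The other end of e is not a leaf, as X meets e in x alone. *)
  rewrite -[RHS]card1 setIDA; congr #|pred_of_set _|; apply/setDidPl.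
  rewrite nbhd_cover -setI_eq0; apply/eqP/setP=> y; rewrite !inE.
  by have := in_setI y e X; rewrite eX inE; case: eqP => //= _ <-.
by rewrite -(degX x xX) -[#|nbhd x|](cardsID (cover D)) card1 setDE.
Qed.

Section StarPartition.
Variables (G : sgraph) (k : nat) (A B C : {set G}).
Hypotheses (k_gt0 : 0 < k) (spABC : star_partition k A B C).

Lemma star_partition_degree b : b \in B -> #|nbhd b| = k.
Proof.
have [_ [_ dAC _] [defV _ _ indB] degB] := spABC => bB.
have [degA degC] := degB b bB.
have -> : nbhd b = nbhd b :&: A :|: nbhd b :&: C.
  rewrite -setIUr; apply/esym/setIidPl/subsetP=> x; rewrite inE => bx.
  have: x \in (A :|: C) :|: B by rewrite defV inE.
  by rewrite inE => /orP[//|xB]; case/negP: (indB b x bB xB).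
rewrite cardsU -setIIr (eqP (_ : A :&: C == set0)) ?setI_eq0 //.
by rewrite setI0 cards0 subn0 degA degC add1n prednK.
Qed.

Lemma star_partition_min_degree : 0 < min_degree G -> min_degree G <= k.
Proof.
have [_ _ partAC _] := spABC => d_gt0.
have [b bB] : exists b, b \in B.
  have /card_gt0P[x _] := leq_trans d_gt0 (min_degree_le_order G).
  have /card_gt0P[y] := leq_trans d_gt0 (min_degree_le x).
  by rewrite inE => /(partite_adj partAC)/orP[]; [exists x | exists y].
by rewrite -(star_partition_degree bB) min_degree_le.
Qed.

Lemma star_partition_size : #|edges G| = #|B| * k.
Proof.
have [_ _ partAC _] := spABC; have [_ _ _ indB] := partAC.
have -> : edges G = edges_between B setT.
  apply/eqP; rewrite eqEsubset edges_between_sub andbT.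
  apply/subsetP=> e /edgesP[x [y [xy ->]]]; apply/edges_betweenP.
  have /orP[xB|yB] := partite_adj partAC xy; first by exists x, y; rewrite inE.
  by exists y, x; rewrite inE adj_sym setUC.
rewrite card_edges_between // -sum_nat_const.
by apply: eq_bigr => b bB; rewrite setIT star_partition_degree.
Qed.

(** An edge that joins ab and a'b' is ab' or a'b; since b and b' have only one
    neighbour in A, this gives a = a', and the edge is one of the two. *)
Lemma star_partition_eop : exists2 D : {set {set G}}, eop_set D & #|D| = #|B|.
Proof.
have [_ _ [_ _ indAC indB] degB] := spABC.
have uniqA b a a' :
    b \in B -> a \in A -> a' \in A -> adj b a -> adj b a' -> a = a'.
  move=> bB aA a'A ba ba'; have [degA _] := degB b bB.
  have /card_le1_eqP eqA : #|nbhd b :&: A| <= 1 by rewrite degA.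
  by apply: eqA; rewrite !inE ?ba ?ba'.
have indA a a' : a \in A -> a' \in A -> ~~ adj a a'.
  by move=> aA a'A; apply: indAC; rewrite inE ?aA ?a'A.
exists (edges_between B A); last first.
  rewrite card_edges_between // -sum1_card.
  by apply: eq_bigr => b bB; case: (degB b bB).
apply/eopP; split=> [|e e' x y]; first exact: edges_between_sub.
case/edges_betweenP=> b [a [bB aA ba ->]].
case/edges_betweenP=> b' [a' [b'B a'A b'a' ->]].
rewrite !(inE, in_set2) => /orP[]/eqP-> /orP[]/eqP->.
- by rewrite (negPf (indB _ _ bB b'B)).
- by move=> ba'; rewrite (uniqA b a a') ?eqxx.
- by rewrite adj_sym => b'a; rewrite (uniqA b' a a') // setUC eqxx orbT.
by rewrite (negPf (indA _ _ aA a'A)).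
Qed.

End StarPartition.

Lemma eop_equality_star_partition (G : sgraph) : 0 < min_degree G ->
  eop_number G * min_degree G = #|edges G| <->
  exists A B C : {set G}, star_partition (min_degree G) A B C.
Proof.
move=> d_gt0; split=> [|[A [B [C spABC]]]].
  by have [D eopD <-] := eop_number_attained G; apply: eop_extremal.
apply/eqP; rewrite eqn_leq; apply/andP; split.
  by have [D eopD <-] := eop_number_attained G; apply: eop_bound.
rewrite (star_partition_size d_gt0 spABC) leq_mul2r.
by have [M eopM <-] := star_partition_eop spABC; rewrite leq_eop_number ?orbT.
Qed.

(** * Disjoint unions of stars *)

Lemma isomorphic_sym (G H : sgraph) : isomorphic G H -> isomorphic H G.
Proof.
case=> f [g fK gK] fadj; exists g; first by exists f.
by move=> x y; rewrite -fadj !gK.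
Qed.

Section LeavesAndCentres.
Variables (G : sgraph) (B : {set G}).
Hypothesis min_deg_gt0 : 0 < min_degree G.
Hypotheses (indB : independent B) (indCB : independent (~: B)).
Hypothesis degB : {in B, forall b, #|nbhd b| = 1}.

Let rays (i : 'I_#|~: B|) := #|nbhd (enum_val i)|.

Let stars := dunion (fun i => Kbip 1 (rays i)).

(** The isomorphism is built from the stars to G: in this direction it is given
    by the enumerations of ~: B and of the neighbourhoods of its vertices, and
    its inverse comes from bijectivity. *)
Let embed (u : stars) : G :=
  match tagged u with
  | inl _ => enum_val (tag u)
  | inr j => enum_val (A := pred_of_set (nbhd (enum_val (tag u)))) j
  end.

Let centre_notin (i : 'I_#|~: B|) : enum_val i \notin B.
Proof. by have := enum_valP i; rewrite inE. Qed.

Let leaf_adj i (j : 'I_(rays i)) :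
  adj (enum_val i) (enum_val (A := pred_of_set (nbhd (enum_val i))) j).
Proof. by have := enum_valP j; rewrite inE. Qed.

Let leaf_in i (j : 'I_(rays i)) :
  enum_val (A := pred_of_set (nbhd (enum_val i))) j \in B.
Proof.
by apply: contraTT (leaf_adj j) => jB; apply: indCB; rewrite inE.
Qed.

Let leaf_adj_uniq b x y : b \in B -> adj x b -> adj y b -> x = y.
Proof.
rewrite ![adj _ b]adj_sym => bB bx by_.
have /card_le1_eqP eq_nbhd : #|nbhd b| <= 1 by rewrite degB.
by apply: eq_nbhd; rewrite inE.
Qed.

Let embed_adj u v : adj (embed u) (embed v) = adj u v.
Proof.
case: u v => i s [j t]; rewrite /embed /= /dunion_rel /=.
have [eq_ij|neq_ij] := eqVneq i j; last first.
  apply/negP; case: s t => [s|s] [t|t]; first 1 last.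
  - move/(leaf_adj_uniq (leaf_in t) (leaf_adj t))/enum_val_inj => eq_ji.
    by rewrite eq_ji eqxx in neq_ij.
  - rewrite adj_sym.
    move/(leaf_adj_uniq (leaf_in s) (leaf_adj s))/enum_val_inj => eq_ij.
    by rewrite eq_ij eqxx in neq_ij.
  - exact/negP/indB.
  by apply/negP/indCB; rewrite inE.
case: _ / eq_ij t => t; rewrite tagged_asE /=.
case: s t => [s|s] [t|t] /=.
- by rewrite adj_irrefl.
- exact: leaf_adj.
- by rewrite adj_sym leaf_adj.
by apply/negbTE/indB.
Qed.

Let embed_inj : injective embed.
Proof.
case=> i s [j t]; rewrite /embed /=; case: s t => [s|s] [t|t] eq_st.
- by rewrite (ord1 s) (ord1 t) (enum_val_inj eq_st).
- by have := centre_notin i; rewrite eq_st leaf_in.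
- by have := centre_notin j; rewrite -eq_st leaf_in.
have eq_ij : i = j.
  apply/enum_val_inj/(leaf_adj_uniq (leaf_in s)); first exact: leaf_adj.
  by rewrite eq_st leaf_adj.
by case: _ / eq_ij t eq_st => t /enum_val_inj->.
Qed.

Let embed_onto x : x \in codom embed.
Proof.
have inC y : y \notin B -> y \in ~: B by rewrite inE.
have [xB|/inC xC] := boolP (x \in B); last first.
  apply/codomP; exists (Tagged (fun i => Kbip 1 (rays i))
    (inl ord0 : Kbip 1 (rays (enum_rank_in xC x)))).
  by rewrite /embed /= enum_rankK_in.
have onto_leaf (i : 'I_#|~: B|) : x \in nbhd (enum_val i) -> x \in codom embed.
  move=> ix; apply/codomP; exists (Tagged (fun i => Kbip 1 (rays i))
    (inr (enum_rank_in ix x) : Kbip 1 (rays i))).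
  by rewrite /embed /= enum_rankK_in.
have: 0 < #|nbhd x| by rewrite degB.
case/card_gt0P=> c; rewrite inE => xc.
have /inC cC : c \notin B by apply: contraTN xc => cB; apply: indB.
apply: (onto_leaf (enum_rank_in cC c)).
by rewrite enum_rankK_in // inE adj_sym.
Qed.

Lemma leaves_disjoint_union_of_stars : disjoint_union_of_stars G.
Proof.
exists #|~: B|, rays; split=> [i|].
  by apply: leq_trans (min_degree_le _).
apply: isomorphic_sym; exists embed; last exact: embed_adj.
exists (fun x => iinv (embed_onto x)) => [u|x]; last exact: f_iinv.
exact: iinv_f.
Qed.

End LeavesAndCentres.

Lemma star_partition1_stars (G : sgraph) (A B C : {set G}) :
  0 < min_degree G -> star_partition 1 A B C -> disjoint_union_of_stars G.
Proof.
move=> d_gt0 spABC; have [_ _ [defV disAC indAC indB] _] := spABC.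
apply: (@leaves_disjoint_union_of_stars G B) => //; last first.
  by move=> b; apply: (@star_partition_degree G 1 A B C).
suff <- : A :|: C = ~: B by [].
apply/setP=> x; rewrite in_setC.
have /setP/(_ x) := defV; rewrite in_setU in_setT.
have [xB _|xB] := boolP (x \in B); last by rewrite orbF.
by rewrite (disjointFl disAC).
Qed.

(** In a star K_2 both vertices have degree 1, so degrees do not tell which of
    them is the leaf; the isomorphism with the union of the graphs Kbip 1 _
    does. *)
Lemma stars_star_partition (G : sgraph) : disjoint_union_of_stars G ->
  exists A B C : {set G}, star_partition 1 A B C.
Proof.
case=> n [r [_ [f [g fK gK] fadj]]].
pose leaf x := if tagged (f x) is inr _ then true else false.
exists [set x | ~~ leaf x], [set x | leaf x], set0.
have same_side x y : leaf x = leaf y -> ~~ adj x y.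
  rewrite /leaf -fadj; case: (f x) (f y) => i [s|s] [j [t|t]] //= _;
    by apply/negP=> /andP[/= /eqP eq_ij]; case: _ / eq_ij t => t;
      rewrite tagged_asE.
split.
- by apply/setP=> x; rewrite !inE orbF orNb.
- split; rewrite -setI_eq0 ?setI0 ?eqxx //.
  by apply/eqP/setP=> x; rewrite !inE andNb.
- rewrite setU0; split.
  + by apply/setP=> x; rewrite !inE orNb.
  + by rewrite -setI_eq0; apply/eqP/setP=> x; rewrite !inE andNb.
  + by move=> x y; rewrite !inE => /negPf xA /negPf yA; rewrite same_side ?xA.
  by move=> x y; rewrite !inE => xB yB; rewrite same_side ?xB.
move=> b; rewrite inE setI0 cards0 => leaf_b; split=> //.
apply/eqP/cards1P; move: leaf_b; rewrite /leaf.
case def_b: (f b) => [i [//|j]] _.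
exists (g (Tagged (fun i => Kbip 1 (r i)) (inl ord0 : Kbip 1 (r i)))).
apply/setP=> x; rewrite !inE -fadj def_b -(can2_eq fK gK).
case: (f x) => i' [s|s] /=; last first.
  rewrite andbF; apply/esym/eqP.
  pose is_centre (u : dunion (fun i => Kbip 1 (r i))) :=
    if tagged u is inl _ then true else false.
  by move/(congr1 is_centre).
rewrite andbT /dunion_rel /=; have [eq_ii|neq_ii] := eqVneq i i'.
  by case: _ / eq_ii s => s; rewrite tagged_asE /= (ord1 s) eqxx.
by apply/esym/eqP => /(congr1 tag) /= eq_ii; rewrite eq_ii eqxx in neq_ii.
Qed.

(** * The characterization *)

Theorem theorem4p1 (G : sgraph) (hG : 1 <= min_degree G) :
  ((eop_number G)%:R = #|edges G|%:R / (min_degree G)%:R :> rat)%R <->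
  disjoint_union_of_stars G \/ in_family_F G.
Proof.
have ratE :
    ((eop_number G)%:R = #|edges G|%:R / (min_degree G)%:R :> rat)%R <->
    eop_number G * min_degree G = #|edges G|.
  have d_neq0 : ((min_degree G)%:R != 0 :> rat)%R by rewrite pnatr_eq0 -lt0n.
  split=> [eq_m|<-]; last by rewrite natrM mulfK.
  by apply/eqP; rewrite -(eqr_nat rat) natrM eq_m divfK.
apply: iff_trans ratE _; apply: iff_trans (eop_equality_star_partition hG) _.
split=> [[A [B [C spABC]]]|].
  have [d_gt1|d_le1] := ltnP 1 (min_degree G).
    by right; exists (min_degree G); split=> //; exists A, B, C.
  left; apply: (@star_partition1_stars G A B C) => //.
  by have -> : 1 = min_degree G by apply/eqP; rewrite eqn_leq hG d_le1.
case=> [/stars_star_partition[A [B [C spABC]]]|[k [_ <- [A [B [C spABC]]]]]];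
  exists A, B, C => //.
suff -> : min_degree G = 1 by [].
by apply/eqP; rewrite eqn_leq hG (star_partition_min_degree _ spABC).
Qed.
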